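(* Let $K$ be a field, let $n\geq 1$, let $A_1,\ldots,A_n$ be finite subsets of $K$ with $d_i=|A_i|$, and let $X^*=A_1\times\cdots\times A_n\subset K^n$. If $2\leq d_i\leq d_{i+1}$ for all $i$ and $d\geq 1$ is an integer, then the minimum distance of the cartesian code $C_{X^*}(d)$ is $$ \delta_{X^*}(d)=\begin{cases}(d_{k+1}-\ell)\,d_{k+2}\cdots d_n & \text{if } d\leq \sum_{i=1}^n(d_i-1)-1,\\ 1 & \text{if } d\geq \sum_{i=1}^n(d_i-1),\end{cases} $$ where, in the first case, $k\geq 0$ and $\ell$ are the unique integers such that $d=\sum_{i=1}^k(d_i-1)+\ell$ and $1\leq \ell\leq d_{k+1}-1$.
   Context: Let $S=K[t_1,\ldots,t_n]$, let $S_{\leq d}$ be the $K$-vector space of polynomials of $S$ of total degree at most $d$, and let $P_1,\ldots,P_m$ be the points of $X^*$. The evaluation map is $\mathrm{ev}_d\colon S_{\leq d}\to K^{|X^*|}$, $f\mapsto (f(P_1),\ldots,f(P_m))$. The cartesian code $C_{X^*}(d)$ is the image of $\mathrm{ev}_d$ (a $K$-linear subspace; $K$ need not be finite). Its minimum distance is $\delta_{X^*}(d)=\min\{\|\mathrm{ev}_d(f)\| : f\in S_{\leq d},\ \mathrm{ev}_d(f)\neq 0\}$, where $\|\cdot\|$ is the number of non-zero entries. The product $d_{k+2}\cdots d_n$ is $1$ if $k=n-1$. *)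

(* Defs.v *)
From HB Require Import structures.
From mathcomp Require Import all_boot all_order all_algebra.
From mathcomp Require Import finmap mpoly.

Set Implicit Arguments.
Unset Strict Implicit.
Unset Printing Implicit Defensive.

Import GRing.Theory.
Local Open Scope fset_scope.
Local Open Scope ring_scope.

(* The points x of K^n with x i \in A i for all i (see cartesian_setP). *)
Definition cartesian_set (K : fieldType) (n : nat) (A : 'I_n -> {fset K}) :
    {fset {ffun 'I_n -> K}} :=
  [fset [ffun i => val ((g : {dffun forall i : 'I_n, A i}) i)] | g in
     {: {dffun forall i : 'I_n, A i}}].

Lemma cartesian_setP (K : fieldType) (n : nat) (A : 'I_n -> {fset K})
    (x : {ffun 'I_n -> K}) :
  reflect (forall i, x i \in A i) (x \in cartesian_set A).
Proof.
apply: (iffP (imfsetP _ _ _ _)) => [[g _ ->] i|xA].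
  by rewrite ffunE; apply: valP.
exists [ffun i => [` xA i]] => //.
by apply/ffunP => i; rewrite !ffunE.
Qed.

(* Evaluation at the points P_0, ..., P_(m-1) of the set X, listed in the
   order of the enumeration of X as a finite type. *)
Definition eval_vector (K : fieldType) (n : nat) (X : {fset {ffun 'I_n -> K}})
    (f : {mpoly K[n]}) : 'rV[K]_#|{: X}| :=
  \row_(j < #|{: X}|) f.@[val (enum_val j)].

(* msize is one more than the total degree, and msize 0 = 0. *)
Definition cartesian_code (K : fieldType) (n : nat) (A : 'I_n -> {fset K})
    (d : nat) (c : 'rV[K]_#|{: cartesian_set A}|) : Prop :=
  exists2 f : {mpoly K[n]}, (msize f <= d.+1)%N
                          & c = eval_vector (cartesian_set A) f.

Definition hamming_weight (K : fieldType) (m : nat) (c : 'rV[K]_m) : nat :=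
  #|[set j | c 0 j != 0]|.

Definition is_minimum_distance (K : fieldType) (m : nat)
    (C : 'rV[K]_m -> Prop) (delta : nat) : Prop :=
  (exists c, [/\ C c, c != 0 & hamming_weight c = delta]) /\
  (forall c, C c -> c != 0 -> (delta <= hamming_weight c)%N).

Lemma cartesian_code_min_distanceE (K : fieldType) (n : nat)
    (A : 'I_n -> {fset K}) (d delta : nat) :
  let ev := eval_vector (cartesian_set A) in
  is_minimum_distance (@cartesian_code K n A d) delta <->
  (exists f, [/\ (msize f <= d.+1)%N, ev f != 0
               & hamming_weight (ev f) = delta]) /\
  (forall f, (msize f <= d.+1)%N -> ev f != 0 ->
     (delta <= hamming_weight (ev f))%N).
Proof.
split=> [] [H1 H2]; split.
- by case: H1 => _ [[f sf ->] nz wt]; exists f.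
- by move=> f sf nz; apply: H2 => //; exists f.
- by case: H1 => f [sf nz wt]; exists (eval_vector _ f); split=> //; exists f.
- by move=> _ [f sf ->] nz; apply: H2.
Qed.

Lemma cartesian_code_linear (K : fieldType) (n : nat)
    (A : 'I_n -> {fset K}) (d : nat) (a : K) (c c' : 'rV[K]_#|{: cartesian_set A}|) :
  cartesian_code d c -> cartesian_code d c' -> cartesian_code d (a *: c + c').
Proof.
move=> [f sf ->] [g sg ->]; exists (a *: f + g).
  apply: leq_trans (msizeD_le _ _) _; rewrite geq_max sg andbT.
  exact: leq_trans (msizeZ_le _ _) sf.
by apply/rowP => j; rewrite !mxE mevalD mevalZ.
Qed.

(* d = sum_(i < k) (d_i - 1) + l with 1 <= l <= d_k - 1, for the sizes d_i of
   the sets A i. Indices start at 0, so that d_k here is d_(k+1) when the sets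
   are numbered from 1; in particular k < n. *)
Definition degree_decomposition (K : fieldType) (n : nat)
    (A : 'I_n -> {fset K}) (d : nat) (k : 'I_n) (l : nat) : Prop :=
  d = (\sum_(i < n | i < k) (#|` A i| - 1) + l)%N /\
  (1 <= l <= #|` A k| - 1)%N.

(* Main.v *)
Require Import Defs.
From HB Require Import structures.
From mathcomp Require Import all_boot all_order all_algebra.
From mathcomp Require Import finmap mpoly.
From mathcomp Require Import zify ring.

Set Implicit Arguments.
Unset Strict Implicit.
Unset Printing Implicit Defensive.

(* Write D i = |A i|. If f does not vanish on the whole grid, let b be the
   number of c in A i such that f vanishes on the slice x i = c. Dividing f
   successively by the corresponding X_i - c leaves g of degree lower by b, which
   on each of the other D i - b slices has the same nonzero points as f and is
   not identically zero. By induction f has at least \prod_i (D i - a i) nonzero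
   points for some a with a i < D i and \sum_i a i <= deg f (Alon-Füredi). For
   nondecreasing D an exchange argument shows that this product is smallest when
   a fills the small factors first. Conversely every such a is realized by a
   product of \sum_i a i hyperplanes X_i - b with b in A i. *)

(** * Decomposing the degree and minimizing the product: arithmetic in [nat] *)

Local Open Scope nat_scope.

(* degree_decomposition A is convertible to mixed_radix (fun i => #|` A i|). *)
Definition mixed_radix n (D : 'I_n -> nat) (d : nat) (k : 'I_n) (l : nat) :=
  d = \sum_(i < n | i < k) (D i - 1) + l /\ 1 <= l <= D k - 1.

Lemma mixed_radix_ord0 n (D : 'I_n.+1 -> nat) d l :
  mixed_radix D d ord0 l <-> d = l /\ 1 <= l <= D ord0 - 1.
Proof. by rewrite /mixed_radix big_pred0. Qed.

(** Removing the first factor drives the inductions on [n] for existence, uniqueness and the closed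
    form of [greedy_bound]. *)
Lemma mixed_radix_lift n (D : 'I_n.+1 -> nat) d k l :
  mixed_radix D d (lift ord0 k) l <->
  D ord0 - 1 <= d /\
  mixed_radix (fun i => D (lift ord0 i)) (d - (D ord0 - 1)) k l.
Proof.
rewrite /mixed_radix big_mkcond big_ord_recl /= -big_mkcond /=.
under eq_bigl => i do rewrite /bump /= !add1n ltnS.
by set s := \sum_(i < n | _) _; split; lia.
Qed.

Lemma mixed_radix_exists n (D : 'I_n -> nat) d :
  1 <= d <= \sum_(i < n) (D i - 1) -> exists k l, mixed_radix D d k l.
Proof.
elim: n D d => [|n IHn] D d; first by rewrite big_ord0; lia.
rewrite big_ord_recl => /andP[d0 dS].
case: (leqP d (D ord0 - 1)) => dD.
  by exists ord0, d; apply/mixed_radix_ord0; rewrite d0.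
case: (IHn (fun i => D (lift ord0 i)) (d - (D ord0 - 1))) => [|k [l kl]].
  by move: dS; set s := \sum_(i < n) _; lia.
by exists (lift ord0 k), l; apply/mixed_radix_lift; split; first exact: ltnW.
Qed.

Lemma mixed_radix_unique n (D : 'I_n -> nat) d k l k' l' :
  mixed_radix D d k l -> mixed_radix D d k' l' -> (k, l) = (k', l').
Proof.
elim: n D d k k' => [|n IHn] D d k k'; first by case: k.
case: (unliftP ord0 k) => [j|] ->; case: (unliftP ord0 k') => [j'|] ->.
- by move=> /mixed_radix_lift[_ kl] /mixed_radix_lift[_ /(IHn _ _ _ _ kl)[-> ->]].
- by move=> /mixed_radix_lift[_ [+ +]] /mixed_radix_ord0; lia.
- by move=> /mixed_radix_ord0 + /mixed_radix_lift[_ [+ +]]; lia.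
- by move=> /mixed_radix_ord0[-> _] /mixed_radix_ord0[-> _].
Qed.

(* The minimum of the products \prod_i (D i - a i) over all a with a i < D i
   and \sum_i a i <= d, for nondecreasing D: it is attained by the a which
   exhausts the factors D 0, D 1, ... in this order. *)
Fixpoint greedy_bound n : ('I_n -> nat) -> nat -> nat :=
  match n with
  | 0 => fun _ _ => 1
  | n'.+1 => fun D d =>
      if d < D ord0 then (D ord0 - d) * \prod_(i < n') D (lift ord0 i)
      else greedy_bound (fun i => D (lift ord0 i)) (d - (D ord0 - 1))
  end.

Lemma greedy_bound0 n (D : 'I_n -> nat) :
  (forall i, 0 < D i) -> greedy_bound D 0 = \prod_(i < n) D i.
Proof.
case: n D => [|n] D D0 /=; first by rewrite big_ord0.
by rewrite D0 subn0 big_ord_recl.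
Qed.

(** The two branches of [greedy_bound] agree at [d = D ord0 - 1], where the first factor is already
    down to 1. *)
Lemma greedy_bound_shift n (D : 'I_n.+1 -> nat) d :
  (forall i, 0 < D i) -> D ord0 - 1 <= d ->
  greedy_bound D d = greedy_bound (fun i => D (lift ord0 i)) (d - (D ord0 - 1)).
Proof.
move=> D0 dD /=; case: ltnP => // dlt; have D00 := D0 ord0.
have -> : d = D ord0 - 1 by lia.
by rewrite subnn greedy_bound0 // subKn // mul1n.
Qed.

Lemma greedy_bound_mixed_radix n (D : 'I_n -> nat) d k l :
  (forall i, 0 < D i) -> mixed_radix D d k l ->
  greedy_bound D d = (D k - l) * \prod_(i < n | k < i) D i.
Proof.
elim: n D d k => [|n IHn] D d k D0; first by case: k.
case: (unliftP ord0 k) => [j|] ->.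
  move=> /mixed_radix_lift[dD kl]; rewrite greedy_bound_shift // (IHn _ _ _ _ kl) //.
  congr (_ * _); rewrite [RHS]big_mkcond big_ord_recl /= mul1n -big_mkcond.
  by apply: eq_bigl => i; rewrite /bump /= !add1n ltnS.
move=> /mixed_radix_ord0[-> lD] /=; rewrite (_ : l < D ord0); last by lia.
by congr (_ * _); rewrite [RHS]big_mkcond big_ord_recl /= mul1n.
Qed.

Lemma greedy_bound_gt0 n (D : 'I_n -> nat) d :
  (forall i, 0 < D i) -> 0 < greedy_bound D d.
Proof.
elim: n D d => [|n IHn] D d D0 //=; case: ifP => dD; last exact: IHn.
by rewrite muln_gt0 subn_gt0 dD; apply: prodn_gt0.
Qed.

(** As [z < y <= D ord0], only the first factor is touched, and
    [(y - z) * D ord0 <= y * (D ord0 - z)]. *)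
Lemma greedy_bound_mul0 n (D : 'I_n -> nat) y z :
  (forall i, y <= D i) -> z < y ->
  (y - z) * \prod_(i < n) D i <= y * greedy_bound D z.
Proof.
case: n D => [|n] D yD zy /=; first by rewrite big_ord0 !muln1 leq_subr.
have y0 := yD ord0; rewrite (leq_trans zy y0) big_ord_recl !mulnA leq_mul2r.
by apply/orP; right; nia.
Qed.

(** The exchange step: [y - 1] further units of degree cost at most a factor [y] when every [D i] is
    at least [y]. *)
Lemma greedy_bound_mul n (D : 'I_n -> nat) y e :
  0 < y -> (forall i, y <= D i) ->
  greedy_bound D e <= y * greedy_bound D (e + (y - 1)).
Proof.
elim: n D e => [|n IHn] D e y0 yD; first by rewrite muln1.
have D0 i : 0 < D i by exact: leq_trans (yD i).
have yD0 := yD ord0.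
case: (leqP (D ord0 - 1) e) => De.
  rewrite !greedy_bound_shift //; last by lia.
  by rewrite addnC -addnBA // addnC; apply: IHn.
(* If all units fit into the first factor, put [t = D ord0 - e - (y - 1) >= 1]; the claim is
   [t + (y - 1) <= y * t]. Otherwise the overflow is the [z] of [greedy_bound_mul0]. *)
case: (ltnP (e + (y - 1)) (D ord0)) => Dey /=.
  rewrite Dey (_ : e < D ord0) ?mulnA ?leq_mul2r; last by lia.
  by apply/orP; right; nia.
rewrite (_ : e < D ord0) ?(ltnNge _ (D ord0)) ?Dey /=; last by lia.
have -> : D ord0 - e = y - (e + (y - 1) - (D ord0 - 1)) by lia.
by apply: greedy_bound_mul0 => //; lia.
Qed.

(** Here [y i] is what remains of [D i]. Induction handles the tail; monotonicity gives
    [y ord0 <= D i] there, so units can be moved from the tail to the first factor. *)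
Lemma greedy_bound_min n (D y : 'I_n -> nat) d :
  (forall i j : 'I_n, i <= j -> D i <= D j) ->
  (forall i, 0 < y i <= D i) ->
  \sum_(i < n) (D i - y i) <= d ->
  greedy_bound D d <= \prod_(i < n) y i.
Proof.
elim: n D y d => [|n IHn] D y d Dmon yD; first by rewrite !big_ord0.
rewrite !big_ord_recl; set s := \sum_(i < n) _ => sd.
have D0 i : 0 < D i by have := yD i; lia.
have y0D : 0 < y ord0 <= D ord0 := yD ord0.
have yDl i : y ord0 <= D (lift ord0 i).
  by apply: leq_trans (Dmon ord0 _ _); case/andP: y0D.
have IH e : s <= e ->
    greedy_bound (fun i => D (lift ord0 i)) e <= \prod_(i < n) y (lift ord0 i).
  move=> se; apply: IHn => // i j ij; apply: Dmon; rewrite /= /bump; lia.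
have {}IH := IH (d - (D ord0 - y ord0)) ltac:(lia).
apply: leq_trans (leq_mul (leqnn (y ord0)) IH).
case: (leqP (D ord0 - 1) d) => Dd.
  rewrite greedy_bound_shift //.
  have -> : d - (D ord0 - y ord0) = d - (D ord0 - 1) + (y ord0 - 1) by lia.
  by apply: greedy_bound_mul => //; lia.
rewrite /= (_ : d < D ord0); last by lia.
have -> : D ord0 - d = y ord0 - (d - (D ord0 - y ord0)) by lia.
by apply: greedy_bound_mul0 => //; lia.
Qed.

(** * Division by hyperplanes on a grid *)

Import GRing.Theory.
Local Open Scope fset_scope.
Local Open Scope ring_scope.

Definition update_coord (K : Type) n (x : {ffun 'I_n -> K}) i c :=
  [ffun j => if j == i then c else x j].

(** The asymmetric bounds absorb the offset between [msize] and degree and cover zero factors. *)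
Lemma msizeM_leq (K : fieldType) n (p q : {mpoly K[n]}) a b :
  (msize p <= a.+1)%N -> (msize q <= b)%N -> (msize (p * q) <= a + b)%N.
Proof.
have [->|p0] := eqVneq p 0; first by rewrite mul0r msize0.
have [->|q0] := eqVneq q 0; first by rewrite mulr0 msize0.
rewrite msizeM //; move: (msize p) (msize q) => u v; lia.
Qed.

Lemma monomial_divided_difference (K : fieldType) n (i : 'I_n) (c : K)
    (m : 'X_{1..n}) :
  exists q : {mpoly K[n]}, (msize q <= mdeg m)%N /\
    forall x : {ffun _ -> _}, 'X_[m].@[x] =
      'X_[m].@[update_coord x i c] + (x i - c) * q.@[x].
Proof.
have [d] := ubnP (mdeg m); elim: d m => // d IHd m.
have [/eqP ->|] := boolP (m == 0%MM).
  by exists 0; rewrite msize0; split=> // x; rewrite mpolyX0 !meval1 meval0 mulr0 addr0.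
rewrite -mdeg_eq0 => m0 md.
have [j mj] : exists j, (0 < m j)%N.
  apply/existsP; apply: contraR m0; rewrite negb_exists => /forallP mE.
  by rewrite mdegE sum_nat_eq0; apply/forallP => j; rewrite -leqn0 leqNgt mE.
have mE : m = (U_(j) + (m - U_(j)))%MM.
  by rewrite addmC submK //; apply/mnm_lepP => h; rewrite mnm1E; case: eqP => // <-.
have dE : mdeg m = (mdeg (m - U_(j))%MM).+1 by rewrite {1}mE mdegD mdeg1.
have [|q [qd qE]] := IHd (m - U_(j))%MM; first by rewrite dE in md.
rewrite dE; move: (m - U_(j))%MM mE qd qE => m' -> qd qE {m md m0 mj dE}.
have [ji|ji] := eqVneq j i.
  (* Write [x i] as [(x i - c) + c] in front of the value of ['X_[m']], then expand only the second
     summand by [qE]. *)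
  exists ('X_[m'] + c *: q); split=> [|x].
    apply: leq_trans (msizeD_le _ _) _; rewrite geq_max msizeX leqnn /=.
    exact: leq_trans (msizeZ_le _ _) (leqW qd).
  rewrite ji mpolyXD !mevalM !mevalXU ffunE eqxx mevalD mevalZ qE; ring.
exists ('X_j * q); split=> [|x].
  by rewrite -add1n; apply: msizeM_leq qd; rewrite msizeX mdeg1.
by rewrite mpolyXD !mevalM !mevalXU ffunE (negPf ji) qE; ring.
Qed.

Lemma divided_difference (K : fieldType) n (i : 'I_n) (c : K) (f : {mpoly K[n]}) :
  exists q : {mpoly K[n]}, (msize q <= (msize f).-1)%N /\
    forall x : {ffun _ -> _}, f.@[x] = f.@[update_coord x i c] + (x i - c) * q.@[x].
Proof.
pose P (h : {mpoly K[n]}) := exists q : {mpoly K[n]}, (msize q <= (msize f).-1)%N /\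
  forall x : {ffun _ -> _}, h.@[x] = h.@[update_coord x i c] + (x i - c) * q.@[x].
(* By linearity; the degree bound in [P] refers to [f] throughout, so it is stable under sums. *)
suff : P (\sum_(m <- msupp f) f@_m *: 'X_[m]) by rewrite -mpolyE.
rewrite big_seq; elim/big_ind: _ => [|p q [p' [sp pE]] [q' [sq qE]]|m mf].
- by exists 0; rewrite msize0; split=> // x; rewrite !meval0 mulr0 addr0.
- exists (p' + q'); split=> [|x].
    by apply: leq_trans (msizeD_le _ _) _; rewrite geq_max sp.
  by rewrite !mevalD pE qE; ring.
have [q [sq qE]] := monomial_divided_difference i c m.
exists (f@_m *: q); split=> [|x]; last by rewrite !mevalZ qE; ring.
apply: leq_trans (msizeZ_le _ _) _; apply: leq_trans sq _.
by have := msize_mdeg_lt mf; lia.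
Qed.

Lemma update_coord_cartesian (K : fieldType) n (A : 'I_n -> {fset K}) x i c :
  x \in cartesian_set A -> c \in A i -> update_coord x i c \in cartesian_set A.
Proof.
move=> /cartesian_setP xA cA; apply/cartesian_setP => j.
by rewrite ffunE; case: eqP => [->|].
Qed.

(** Replacing [x i] by [c] stays in the grid and lands where [f] vanishes, so the divided difference
    is an exact quotient there. Truncated subtraction is harmless: if [size s] reaches [msize f],
    then [g] is 0. *)
Lemma factor_hyperplanes (K : fieldType) n (A : 'I_n -> {fset K}) (i : 'I_n)
    (s : seq K) (f : {mpoly K[n]}) :
  uniq s -> {subset s <= A i} ->
  (forall x, x \in cartesian_set A -> x i \in s -> f.@[x] = 0) ->
  exists g : {mpoly K[n]}, (msize g <= msize f - size s)%N /\
    forall x, x \in cartesian_set A ->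
      f.@[x] = (\prod_(c <- s) (x i - c)) * g.@[x].
Proof.
elim: s f => [|c s IHs] f /=.
  by move=> _ _ _; exists f; split=> [|x _]; rewrite ?subn0 // big_nil mul1r.
move=> /andP[cs us] sA f0.
have cA : c \in A i by rewrite sA ?mem_head.
have [q [sq qE]] := divided_difference i c f.
have fE x : x \in cartesian_set A -> f.@[x] = (x i - c) * q.@[x].
  move=> xA; rewrite qE f0 ?add0r ?update_coord_cartesian //.
  by rewrite ffunE eqxx mem_head.
have [|x xA xs|g [sg gE]] := IHs q us.
- by move=> z zs; apply: sA; rewrite inE zs orbT.
(* The quotient still vanishes on the remaining slices: [x i - c] is nonzero there because the list
   has no duplicates. *)
- have /eqP := f0 x xA (mem_behead (s := c :: s) xs).
  rewrite fE // mulf_eq0 subr_eq0 => /orP[/eqP xc|/eqP //].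
  by rewrite -xc xs in cs.
exists g; split=> [|x xA]; first by lia.
by rewrite fE // gE // big_cons mulrA.
Qed.

(** * Counting nonzero points by slices, and the Alon-Füredi bound *)

Definition nonzero_points (K : fieldType) n (A : 'I_n -> {fset K}) (f : {mpoly K[n]}) :=
  [fset x in cartesian_set A | f.@[x : {ffun 'I_n -> K}] != 0].

Definition slice (K : fieldType) n (A : 'I_n -> {fset K}) i c j :=
  if j == i then [fset c] else A j.

Lemma slice_cartesianE (K : fieldType) n (A : 'I_n -> {fset K}) i c x :
  c \in A i ->
  (x \in cartesian_set (slice A i c)) = (x \in cartesian_set A) && (x i == c).
Proof.
move=> cA; apply/cartesian_setP/andP => [xS|[/cartesian_setP xA /eqP xi] j].
  have /eqP xi : x i == c by have := xS i; rewrite /slice eqxx inE.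
  rewrite xi; split=> //; apply/cartesian_setP => j.
  by have := xS j; rewrite /slice; case: eqP => // -> _; rewrite xi.
by rewrite /slice; case: eqP => // ->; rewrite inE xi.
Qed.

Lemma card_nonzero_points_slice (K : fieldType) n (A : 'I_n -> {fset K}) i f :
  #|` nonzero_points A f| =
  (\sum_(c <- A i) #|` nonzero_points (slice A i c) f|)%N.
Proof.
rewrite -sum1_size big_seq.
(* Double counting: each point meets exactly one slice. *)
transitivity (\sum_(x <- nonzero_points A f | x \in nonzero_points A f)
   \sum_(c <- A i | x i == c) 1)%N.
  apply: eq_bigr => x; rewrite !inE => /andP[/cartesian_setP xA _].
  rewrite -big_filter -(eq_filter (a1 := pred1 (x i))); last by move=> c; rewrite /= eq_sym.
  by rewrite filter_pred1_uniq ?fset_uniq // big_seq1.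
rewrite -big_seq.
rewrite (exchange_big_dep predT) //= big_seq [RHS]big_seq; apply: eq_bigr => c cA.
rewrite big_fset_condE sum1_size; congr (size _); congr enum_fset.
by apply/fsetP => x; rewrite !inE slice_cartesianE // andbAC.
Qed.

Lemma card_cartesian_set (K : fieldType) n (A : 'I_n -> {fset K}) :
  #|` cartesian_set A| = (\prod_(i < n) #|` A i|)%N.
Proof.
rewrite card_imfset /=; last first.
  move=> g h /ffunP gh; apply/ffunP => i; have := gh i.
  by rewrite !ffunE => /val_inj.
rewrite -cardE.
transitivity (foldr muln 1%N [seq #|A i : finType| | i : 'I_n]).
  exact: card_dep_ffun.
rewrite foldrE big_map big_enum; apply: eq_bigr => i _; exact/esym/cardfE.
Qed.

Lemma hamming_weight_eval_vector (K : fieldType) n (A : 'I_n -> {fset K}) f :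
  hamming_weight (eval_vector (cartesian_set A) f) = #|` nonzero_points A f|.
Proof.
rewrite /hamming_weight -sum1_card -sum1_size [RHS]big_fset /= big_seq_fsetE /=.
rewrite (reindex _ (onW_bij _ (@enum_val_bij (cartesian_set A)))) /=.
by apply: eq_bigl => j; rewrite inE mxE.
Qed.

(* The induction fixes the number n of variables and shrinks the factors A i
   with m <= i to singletons, so that slicing stays inside {mpoly K[n]}. *)
Lemma alon_furedi_rec (K : fieldType) n m (A : 'I_n -> {fset K}) (f : {mpoly K[n]}) :
  (forall i : 'I_n, (m <= i)%N -> #|` A i| = 1%N) ->
  nonzero_points A f != fset0 ->
  exists a : 'I_n -> nat,
    [/\ forall i, (a i < #|` A i|)%N, (\sum_i a i < msize f)%N
      & (\prod_i (#|` A i| - a i) <= #|` nonzero_points A f|)%N].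
Proof.
elim: m A f => [|m IHm] A f A1 nz.
  (* The grid is a single point, so the product is 1 and it suffices that [f] is nonzero. *)
  exists (fun=> 0%N); split=> [i||]; first by rewrite A1.
    rewrite big1 // lt0n msize_poly_eq0; apply: contraNneq nz => ->.
    by apply/eqP/fsetP => x; rewrite !inE meval0 eqxx andbF.
  by rewrite big1 ?cardfs_gt0 // => i _; rewrite subn0 A1.
have [mn|nm] := ltnP m n; last first.
  by apply: IHm => // i mi; have := leq_trans nm mi; rewrite leqNgt ltn_ord.
pose i := Ordinal mn.
pose s := [seq c <- A i | nonzero_points (slice A i c) f == fset0].
have [|||g [sg fg]] := @factor_hyperplanes K n A i s f.
- exact/filter_uniq/fset_uniq.
- by move=> c; rewrite mem_filter => /andP[].
- move=> x xA; rewrite mem_filter => /andP[/eqP/fsetP/(_ x)].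
  by rewrite !inE => + xi; rewrite slice_cartesianE // xA eqxx /= => /negbFE/eqP.
have fgE c : c \in A i -> c \notin s ->
    nonzero_points (slice A i c) g = nonzero_points (slice A i c) f.
  move=> cA cs; apply/fsetP => x; rewrite !inE slice_cartesianE //.
  have [/andP[xA /eqP xc]|//] := boolP ((x \in cartesian_set A) && (x i == c)).
  rewrite fg // mulf_eq0 negb_or.
  case: (_ != 0); rewrite ?andbF //= andbT; apply/esym; rewrite prodf_seq_neq0.
  by apply/allP => z zs; rewrite subr_eq0 xc; apply: contraNneq cs => ->.
have szs c : c \in A i -> c \notin s -> nonzero_points (slice A i c) f != fset0.
  by rewrite mem_filter => ->; rewrite andbT.
have [x0 x0A] := fset0Pn _ nz; move: x0A; rewrite !inE => /andP[x0A fx0].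
have c0A : x0 i \in A i by move/cartesian_setP: x0A.
have c0s : x0 i \notin s.
  rewrite mem_filter c0A andbT; apply/fset0Pn; exists x0.
  by rewrite !inE slice_cartesianE // x0A eqxx.
(* Induction is applied only to the slice with fewest nonzero points among those where [f] does not
   vanish identically; its bound then holds on all of them. *)
have [/= c cns cmin] := @arg_minnP _ [` c0A] (fun z : A i => val z \notin s)
  (fun z => #|` nonzero_points (slice A i (val z)) f|) c0s.
have [||a [aA sa pa]] := IHm (slice A i (val c)) g.
- move=> j mj; rewrite /slice; case: eqP => [_|/eqP ji]; first by rewrite cardfs1.
  by apply: A1; rewrite ltn_neqAle mj andbT; apply: contra ji => /eqP e; exact/eqP/val_inj.
- by rewrite fgE ?szs //; apply: valP.
have ai0 : a i = 0%N by have := aA i; rewrite /slice eqxx cardfs1 ltnS leqn0 => /eqP.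
exists (fun j => if j == i then size s else a j); split.
- move=> j; case: eqP => [->|/eqP ji]; last by have := aA j; rewrite /slice (negPf ji).
  rewrite size_filter -(count_predC (fun c => nonzero_points (slice A i c) f == fset0) (A i)).
  rewrite -addn1 leq_add2l -has_count; apply/hasP; exists (x0 i) => //=.
  by move: c0s; rewrite mem_filter c0A andbT.
- rewrite (bigD1 i) //= eqxx (eq_bigr a) => [|j /negPf -> //].
  move: sa; rewrite (bigD1 i) //= ai0 add0n -ltn_subRL => sa.
  exact: leq_trans sa sg.
rewrite (card_nonzero_points_slice _ i) (bigD1 i) //= eqxx.
rewrite (eq_bigr (fun j => #|` slice A i (val c) j| - a j)%N) => [|j /negPf ji]; last first.
  by rewrite /slice ji.
move: pa; rewrite (bigD1 i) //= {1}/slice eqxx cardfs1 ai0 subn0 mul1n.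
set P := (\prod_(_ | _) _)%N => pa.
rewrite fgE ?fsvalP // in pa.
rewrite (bigID (fun z => z \in s)) /=.
apply: leq_trans (leq_addl _ _).
apply: (@leq_trans (\sum_(z <- A i | z \notin s) P)%N).
  rewrite big_const_seq iter_addn_0 mulnC leq_mul2l; apply/orP; right.
  rewrite leq_subLR -(count_predC (fun z => z \in s)) leq_add2r -size_filter.
  apply: uniq_leq_size; first exact/filter_uniq/fset_uniq.
  by move=> z; rewrite mem_filter => /andP[].
rewrite big_seq_cond [X in (_ <= X)%N]big_seq_cond.
apply: leq_sum => z /andP[zA zs]; apply: leq_trans pa _.
exact: (cmin [` zA]).
Qed.

Lemma alon_furedi (K : fieldType) n (A : 'I_n -> {fset K}) (f : {mpoly K[n]}) :
  nonzero_points A f != fset0 ->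
  exists a : 'I_n -> nat,
    [/\ forall i, (a i < #|` A i|)%N, (\sum_i a i < msize f)%N
      & (\prod_i (#|` A i| - a i) <= #|` nonzero_points A f|)%N].
Proof. by apply: (@alon_furedi_rec K n n) => i; rewrite leqNgt ltn_ord. Qed.

(** * Polynomials attaining the bound *)

Definition hyperplane_product (K : fieldType) n (B : 'I_n -> {fset K}) : {mpoly K[n]} :=
  \prod_(i < n) \prod_(b <- B i) ('X_i - b%:MP).

Lemma msize_hyperplane_product (K : fieldType) n (B : 'I_n -> {fset K}) :
  (msize (hyperplane_product B) <= (\sum_(i < n) #|` B i|).+1)%N.
Proof.
rewrite /hyperplane_product; elim/big_ind2: _ => [|p u q v pu qv|i _].
- by rewrite msize1.
- by rewrite -addnS; apply: msizeM_leq.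
elim: (enum_fset (B i)) => [|b s IHs]; first by rewrite big_nil msize1.
rewrite big_cons /= -addn1 addSn -add1n; apply: msizeM_leq; last by rewrite addn1.
apply: leq_trans (msizeD_le _ _) _; rewrite geq_max msizeN msizeC msizeX mdeg1 /=.
by case: eqP.
Qed.

Lemma nonzero_points_hyperplane_product (K : fieldType) n (A B : 'I_n -> {fset K}) :
  nonzero_points A (hyperplane_product B) = cartesian_set (fun i => A i `\` B i).
Proof.
apply/fsetP => x; rewrite !inE /hyperplane_product rmorph_prod /=.
apply/andP/cartesian_setP => [[/cartesian_setP xA /prodf_neq0 xB] i|xAB].
  rewrite inE xA andbT; have := xB i isT; apply: contra => xi.
  rewrite rmorph_prod prodf_seq_eq0; apply/hasP; exists (x i) => //=.
  by rewrite mevalB mevalXU mevalC subrr.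
split; first by apply/cartesian_setP => i; have := xAB i; rewrite inE => /andP[].
apply/prodf_neq0 => i _; rewrite rmorph_prod prodf_seq_neq0; apply/allP => b bB /=.
rewrite mevalB mevalXU mevalC subr_eq0; apply: contraTneq bB => <-.
by have := xAB i; rewrite inE => /andP[].
Qed.

Lemma exists_card_nonzero_points (K : fieldType) n (A : 'I_n -> {fset K}) (a : 'I_n -> nat) :
  (forall i, (a i <= #|` A i|)%N) ->
  exists2 f : {mpoly K[n]}, (msize f <= (\sum_i a i).+1)%N
    & #|` nonzero_points A f| = (\prod_i (#|` A i| - a i))%N.
Proof.
move=> aA; pose B i := [fset x in take (a i) (A i)].
have cB i : #|` B i| = a i.
  rewrite card_imfset //= undup_id; last by rewrite take_uniq.
  by rewrite size_takel.
have sB i : B i `<=` A i.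
  by apply/fsubsetP => x; rewrite !inE => /mem_take.
exists (hyperplane_product B).
  by rewrite -(eq_bigr _ (fun i _ => cB i)); apply: msize_hyperplane_product.
rewrite nonzero_points_hyperplane_product card_cartesian_set.
by apply: eq_bigr => i _; rewrite cardfsDS ?cB.
Qed.

Lemma eval_vector_neq0 (K : fieldType) n (A : 'I_n -> {fset K}) (f : {mpoly K[n]}) :
  (eval_vector (cartesian_set A) f != 0) = (nonzero_points A f != fset0).
Proof.
rewrite -cardfs_gt0 -hamming_weight_eval_vector card_gt0; congr (~~ _).
apply/eqP/eqP => [->|/setP w0]; first by apply/setP => j; rewrite !inE mxE eqxx.
by apply/rowP => j; have := w0 j; rewrite !inE !mxE => /negbFE/eqP.
Qed.

(** * The minimum distance *)

(** Reduces both cases of the theorem to exhibiting an optimal [a]: a product of hyperplanes attains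
    its value, and Alon-Füredi with [greedy_bound_min] bounds all weights below. *)
Lemma min_distance_greedy (K : fieldType) n (A : 'I_n -> {fset K}) d
    (a : 'I_n -> nat) :
  (forall i j : 'I_n, (i <= j)%N -> (#|` A i| <= #|` A j|)%N) ->
  (forall i, (a i < #|` A i|)%N) -> (\sum_i a i <= d)%N ->
  (\prod_i (#|` A i| - a i) <= greedy_bound (fun i => #|` A i|) d)%N ->
  is_minimum_distance (@cartesian_code K n A d) (\prod_i (#|` A i| - a i))%N.
Proof.
move=> Amon aA ad ag; apply/cartesian_code_min_distanceE; split=> [|f sf].
  have [f sf cf] := exists_card_nonzero_points (fun i => ltnW (aA i)).
  exists f; rewrite hamming_weight_eval_vector eval_vector_neq0 -cardfs_gt0 cf; split=> //.
    by apply: leq_trans sf _.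
  by apply: prodn_gt0 => i; rewrite subn_gt0.
rewrite eval_vector_neq0 hamming_weight_eval_vector => /alon_furedi[b [bA sb pb]].
apply: leq_trans pb; apply: leq_trans ag _; apply: greedy_bound_min => // [i|].
  by have := bA i; lia.
rewrite -ltnS; apply: leq_trans sf; apply: leq_ltn_trans sb.
by apply: leq_sum => i _; have := bA i; lia.
Qed.

Theorem theorem3p8 (K : fieldType) (n : nat) (hn : (1 <= n)%N)
    (A : 'I_n -> {fset K})
    (hA2 : forall i : 'I_n, (2 <= #|` A i|)%N)
    (hAmon : forall i j : 'I_n, nat_of_ord j = i.+1 ->
       (#|` A i| <= #|` A j|)%N)
    (d : nat) (hd : (1 <= d)%N) :
  ((d <= \sum_(i < n) (#|` A i| - 1) - 1)%N ->
     (exists! kl : 'I_n * nat, degree_decomposition A d kl.1 kl.2) /\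
     (forall (k : 'I_n) (l : nat), degree_decomposition A d k l ->
        is_minimum_distance (@cartesian_code K n A d)
          ((#|` A k| - l) * \prod_(i < n | k < i) #|` A i|)%N)) /\
  ((\sum_(i < n) (#|` A i| - 1) <= d)%N ->
     is_minimum_distance (@cartesian_code K n A d) 1).
Proof.
have A0 i : (0 < #|` A i|)%N by apply: ltnW.
have Amon (i j : 'I_n) : (i <= j)%N -> (#|` A i| <= #|` A j|)%N.
  move=> ij; have [m jE] : exists m, (j = i + m :> nat)%N by exists (j - i)%N; rewrite subnKC.
  elim: m j jE {ij} => [|m IHm] j jE.
    by rewrite (_ : j = i) //; apply: val_inj; rewrite /= jE addn0.
  have mn : (i + m < n)%N by rewrite (ltn_trans _ (ltn_ord j)) // jE addnS.
  by apply: leq_trans (IHm (Ordinal mn) erefl) (hAmon _ _ _); rewrite jE addnS.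
split=> [dS|dS].
  split.
    have [|k [l kl]] := @mixed_radix_exists n (fun i => #|` A i|) d.
      by rewrite hd; apply: leq_trans dS (leq_subr _ _).
    by exists (k, l); split=> // -[k' l']; apply: mixed_radix_unique.
  move=> k l kl; have [dE /andP[l1 lA]] := kl.
  (* The greedy choice: exhaust the factors before [k] and take the remaining [l] from factor
     [k]. *)
  pose a (i : 'I_n) := if (i < k)%N then (#|` A i| - 1)%N else if i == k then l else 0%N.
  have aE : (\prod_i (#|` A i| - a i) =
             (#|` A k| - l) * \prod_(i < n | k < i) #|` A i|)%N.
    rewrite (bigD1 k) //= {1}/a ltnn eqxx; congr (_ * _)%N.
    rewrite big_mkcond [RHS]big_mkcond; apply: eq_bigr => i _; rewrite /a -val_eqE /=.
    by case: ltngtP => _ //=; rewrite ?subn0 ?subKn.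
  rewrite -aE; apply: min_distance_greedy => //.
  - move=> i; rewrite /a; have := A0 i; have := A0 k.
    by case: ifP => _; [|case: eqP => [->|_]]; lia.
  - rewrite dE (bigID (fun i : 'I_n => (i < k)%N)) /=; apply: leq_add.
      by apply: leq_sum => i ik; rewrite /a ik.
    rewrite (bigD1 k) ?ltnn //= {1}/a ltnn eqxx big1 ?addn0 // => i /andP[ik].
    by rewrite /a (negPf ik) => ik'; rewrite (negPf ik').
  - by rewrite aE (greedy_bound_mixed_radix A0 kl).
(* The degree now suffices to exhaust every factor; the value 1 is optimal because [greedy_bound] is
   positive. *)
have aE : (\prod_i (#|` A i| - (#|` A i| - 1)) = 1)%N.
  by rewrite big1 // => i _; rewrite subKn.
rewrite -[X in is_minimum_distance _ X]aE; apply: min_distance_greedy => // [i|].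
  by have := A0 i; lia.
by rewrite aE; apply: greedy_bound_gt0.
Qed.
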